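(* Let $\mathfrak{B}$ be a Bol algebra of dimension 3 with trilinear operation of Type V$^+$ whose canonical enveloping Lie algebra has dimension 4. Then $\mathfrak{B}$ is isotopic to one of the following Bol algebras with basis $e_1,e_2,e_3$, in each of which $(e_2,e_3,e_2)=e_1$ and $(e_2,e_3,e_3)=-e_2$ (all operations on basis vectors not listed, and not following by skew-symmetry in the first two arguments, are zero): (i) $e_2\cdot e_3=-e_3$; (ii) $e_2\cdot e_3=e_2$; (iii) trivial bilinear operation.
   Context: A Bol algebra is a finite-dimensional real vector space $\mathfrak{B}$ with a bilinear operation $x\cdot y$ and a trilinear operation $(x,y,z)$ such that for all elements: $x\cdot x=0$; $(x,x,y)=0$; $(x,y,z)+(y,z,x)+(z,x,y)=0$; $(x,y,(z,\xi,\eta))=((x,y,z),\xi,\eta)+(z,(x,y,\xi),\eta)+(z,\xi,(x,y,\eta))$; $(x,y,z)\cdot\xi-(x,y,\xi)\cdot z+(z,\xi,x\cdot y)-(x,y,z\cdot\xi)+(x\cdot y)\cdot(z\cdot\xi)=0$. Type V$^+$: the trilinear operation is of Type V$^+$ if in some basis $e_1,e_2,e_3$ of $\mathfrak{B}$ it is given by $(e_2,e_3,e_2)=e_1$, $(e_2,e_3,e_3)=-e_2$ (together with the values forced by skew-symmetry in the first two arguments), all other $(e_i,e_j,e_k)$ being zero. Canonical enveloping Lie algebra: an enveloping pair of a Bol algebra $\mathfrak{B}$ consists of a finite-dimensional real Lie algebra $\mathfrak{G}$ containing $\mathfrak{B}$ as a vector subspace and a subalgebra $\mathfrak{h}$ with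 $\mathfrak{G}=\mathfrak{B}\oplus\mathfrak{h}$ (direct sum of vector spaces), $[[\mathfrak{B},\mathfrak{B}],\mathfrak{B}]\subset\mathfrak{B}$, $x\cdot y$ equal to the projection of $[x,y]$ onto $\mathfrak{B}$ parallel to $\mathfrak{h}$, and $(x,y,z)=[[x,y],z]$. It is canonical if $\mathfrak{B}$ generates $\mathfrak{G}$ as a Lie algebra and $\mathfrak{h}$ contains no nonzero ideal of $\mathfrak{G}$. Isotopic Bol algebras: let $\mathfrak{G}=\mathfrak{B}\oplus\mathfrak{h}$ and $\widetilde{\mathfrak{G}}=\widetilde{\mathfrak{B}}\oplus\widetilde{\mathfrak{h}}$ be the canonical enveloping Lie algebras of $\mathfrak{B}$ and $\widetilde{\mathfrak{B}}$. The Bol algebras are isotopic if there exist a Lie algebra isomorphism $\Phi:\mathfrak{G}\to\widetilde{\mathfrak{G}}$ with $\Phi(\mathfrak{B})=\widetilde{\mathfrak{B}}$ and an element $\xi\in\widetilde{\mathfrak{B}}$ such that $\Phi(\mathfrak{h})=(\mathrm{Ad}\,\xi)\,\widetilde{\mathfrak{h}}$, where $\mathrm{Ad}\,\xi=\exp(\mathrm{ad}\,\xi)$. *)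

(* Defs.v *)
From mathcomp Require Import all_boot all_order all_algebra.
From mathcomp Require Import all_classical all_reals all_analysis.

Set Implicit Arguments.
Unset Strict Implicit.
Unset Printing Implicit Defensive.

Import Order.TTheory GRing.Theory Num.Theory numFieldNormedType.Exports.

Local Open Scope classical_set_scope.
Local Open Scope ring_scope.

(* [vectType R] is the library's interface for finite-dimensional spaces. *)
Record lieAlgebra (R : realType) := LieAlgebra {
  lie_space :> vectType R;
  lie : lie_space -> lie_space -> lie_space;
  lie_linearl : forall y, linear (fun x => lie x y);
  lie_linearr : forall x, linear (lie x);
  lie_alt : forall x, lie x x = 0;
  lie_jacobi : forall x y z,
    lie x (lie y z) + lie y (lie z x) + lie z (lie x y) = 0
}.

Record bolAlgebra (R : realType) := BolAlgebra {
  bol_space :> vectType R;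
  dot : bol_space -> bol_space -> bol_space;
  tri : bol_space -> bol_space -> bol_space -> bol_space;
  dot_linearl : forall y, linear (fun x => dot x y);
  dot_linearr : forall x, linear (dot x);
  tri_linear1 : forall y z, linear (fun x => tri x y z);
  tri_linear2 : forall x z, linear (fun y => tri x y z);
  tri_linear3 : forall x y, linear (tri x y);
  dot_alt : forall x, dot x x = 0;
  tri_alt : forall x y, tri x x y = 0;
  tri_cyclic : forall x y z, tri x y z + tri y z x + tri z x y = 0;
  tri_deriv : forall x y z u v,
    tri x y (tri z u v)
      = tri (tri x y z) u v + tri z (tri x y u) v + tri z u (tri x y v);
  bol_identity : forall x y z u,
    dot (tri x y z) u - dot (tri x y u) z + tri z u (dot x y)
      - tri x y (dot z u) + dot (dot x y) (dot z u) = 0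
}.

Section Envelopes.
Context {R : realType}.
Implicit Types (B : bolAlgebra R) (G : lieAlgebra R).

Definition is_subalgebra G (K : {vspace G}) : Prop :=
  {in K &, forall u v, lie u v \in K}.

Definition is_ideal G (I : {vspace G}) : Prop :=
  forall u v, v \in I -> lie u v \in I.

(* The inclusion of the Bol algebra in [G] is an injective linear map [i].
   [daddv_pi U V] is the projection onto [U] parallel to [V]. *)
Record enveloping_pair B G (i : 'Hom(B, G)) (h : {vspace G}) : Prop :=
  EnvelopingPair {
  env_inj : injective i;
  env_subalgebra : is_subalgebra h;
  env_sum : (limg i + h)%VS = fullv;
  env_direct : (limg i :&: h)%VS = 0%VS;
  env_triple_closed : {in limg i & &, forall x y z,
    lie (lie x y) z \in limg i};
  env_dot : forall x y, i (dot x y) = daddv_pi (limg i) h (lie (i x) (i y));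
  env_tri : forall x y z, i (tri x y z) = lie (lie (i x) (i y)) (i z)
}.

Record canonical_envelope B G (i : 'Hom(B, G)) (h : {vspace G}) : Prop :=
  CanonicalEnvelope {
  canon_enveloping : enveloping_pair i h;
  canon_generates : forall K : {vspace G},
    is_subalgebra K -> (limg i <= K)%VS -> K = fullv;
  canon_core_free : forall I : {vspace G},
    is_ideal I -> (I <= h)%VS -> I = 0%VS
}.

(* [exp_end f v] is the sum of [f^k v / k!] over all [k].  The space [V] carries no
   topology in the library: the limit is taken coordinatewise, which for a
   linear [f] does not depend on the basis. *)
Definition exp_end (V : vectType R) (f : V -> V) (v : V) : V :=
  \sum_(j < \dim {:V})
    limn (series (fun k => coord (vbasis {:V}) j (iter k f v) / k`!%:R))
      *: (vbasis {:V})`_j.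

Definition Ad G (x : G) : G -> G := exp_end (lie x).

Definition lie_isomorphism G G' (Phi : 'Hom(G, G')) : Prop :=
  bijective Phi /\ forall u v, Phi (lie u v) = lie (Phi u) (Phi v).

(* A canonical envelope is unique up to an isomorphism compatible with the
   inclusion of the Bol algebra and with the complement [h], so it does not
   matter which ones are chosen. *)
Definition isotopic B B' : Prop :=
  exists (G : lieAlgebra R) (i : 'Hom(B, G)) (h : {vspace G})
         (G' : lieAlgebra R) (i' : 'Hom(B', G')) (h' : {vspace G'}),
    [/\ canonical_envelope i h, canonical_envelope i' h' &
      exists (Phi : 'Hom(G, G')) (xi : G'),
        [/\ lie_isomorphism Phi,
            (Phi @: limg i)%VS = limg i',
            xi \in limg i' &
            Phi @` [set` h] = Ad xi @` [set` h']]].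

Definition typeVplus_basis B (e1 e2 e3 : B) : Prop :=
  [/\ basis_of fullv [:: e1; e2; e3],
      {in [:: e1; e2; e3], forall z, tri e1 e2 z = 0},
      {in [:: e1; e2; e3], forall z, tri e1 e3 z = 0} &
      [/\ tri e2 e3 e1 = 0, tri e2 e3 e2 = e1 & tri e2 e3 e3 = - e2]].

Definition typeVplus B : Prop :=
  exists e1 e2 e3 : B, typeVplus_basis e1 e2 e3.

End Envelopes.

(* Main.v *)
Require Import Defs.
From HB Require Import structures.
From mathcomp Require Import all_boot all_order all_algebra.
From mathcomp Require Import all_classical all_reals all_analysis.
From mathcomp Require Import ring.
Import Order.TTheory GRing.Theory Num.Theory numFieldNormedType.Exports.
Set Implicit Arguments.
Unset Strict Implicit.
Unset Printing Implicit Defensive.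
Local Open Scope ring_scope.

(** Let D be the bracket of e2 and e3 in the envelope G.  The trilinear operation
    says that ad D sends e1 to 0, e2 to e1 and e3 to - e2, and that the brackets
    of e1 with e2 and with e3 commute with the image of B.  An element of that
    image which commutes with D is a multiple of e1; it follows that D lies
    outside the image ([envelope_notin]), so that G, of dimension 4, is the
    direct sum of the image of B and the line of D.  This in turn forces e1 to
    commute with e2 and e3 ([envelope_e1_central]).  Thus G is the oscillator
    algebra: e1 is central and ad e3 rotates the plane of D and e2.

    The complement h is therefore the line of D - w, where
    w = a e1 + b e2 + c e3 is the product of e2 and e3 ([complement_line]), the
    other products of basis vectors being zero ([dot_e1]).  It remains to
    normalize this line.

    - If c is nonzero, a change of basis which preserves the form of the
      trilinear operation ([Vplus_rebase]) makes w equal to minus the new third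
      basis vector ([Vplus_normal_form]); the algebra itself is unchanged.
    - If c = 0, then h is spanned by D - a e1 - b e2.  When b is nonzero, h is
      the image of the line of D under Ad of a multiple theta of
      e3 - (a / b) e2, which acts as a rotation of angle theta, with
      tan theta = - b; when b = 0, it is the image under Ad (a e2), which shears
      D along e1.  On the same triple system, the line of D is the complement
      which defines the zero product, so B is isotopic to the algebra with zero
      product ([Vplus_isotopic_trivial]).

    The exponentials are summed in [exp_end_rotation] and [exp_end_nilpotent]. *)

(** * Multilinear calculus in Lie and Bol algebras *)

HB.instance Definition _ (R : realType) (G : lieAlgebra R) (x : G) :=
  GRing.isLinear.Build R G G _ (@lie R G x) (@lie_linearr R G x).
HB.instance Definition _ (R : realType) (B : bolAlgebra R) (x : B) :=
  GRing.isLinear.Build R B B _ (@dot R B x) (@dot_linearr R B x).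
HB.instance Definition _ (R : realType) (B : bolAlgebra R) (x y : B) :=
  GRing.isLinear.Build R B B _ (@tri R B x y) (@tri_linear3 R B x y).

Lemma lieC (R : realType) (G : lieAlgebra R) (x y : G) : lie x y = - lie y x.
Proof.
have lieDl u v w : @lie R G (u + v) w = lie u w + lie v w.
  by have := lie_linearl w 1 u v; rewrite !scale1r.
have := lie_alt (x + y).
by rewrite lieDl !linearD /= !lie_alt addr0 add0r => /eqP; rewrite addr_eq0 => /eqP.
Qed.

Lemma lieDl (R : realType) (G : lieAlgebra R) (x y z : G) :
  lie (x + y) z = lie x z + lie y z.
Proof. by rewrite lieC linearD opprD -!lieC. Qed.

Lemma lieZl (R : realType) (G : lieAlgebra R) (a : R) (x y : G) :
  lie (a *: x) y = a *: lie x y.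
Proof. by rewrite lieC linearZ /= -scalerN -lieC. Qed.

Lemma lie0l (R : realType) (G : lieAlgebra R) (y : G) : lie 0 y = 0.
Proof. by rewrite lieC linear0 oppr0. Qed.

Lemma lieDr (R : realType) (G : lieAlgebra R) (x y z : G) :
  lie x (y + z) = lie x y + lie x z.
Proof. exact: linearD. Qed.

Lemma lieZr (R : realType) (G : lieAlgebra R) (a : R) (x y : G) :
  lie x (a *: y) = a *: lie x y.
Proof. exact: linearZ. Qed.

Lemma lieNr (R : realType) (G : lieAlgebra R) (x y : G) :
  lie x (- y) = - lie x y.
Proof. exact: linearN. Qed.

Lemma dotC (R : realType) (B : bolAlgebra R) (x y : B) : dot x y = - dot y x.
Proof.
have dotDl u v w : @dot R B (u + v) w = dot u w + dot v w.
  by have := dot_linearl w 1 u v; rewrite !scale1r.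
have := dot_alt (x + y).
by rewrite dotDl !linearD /= !dot_alt addr0 add0r => /eqP; rewrite addr_eq0 => /eqP.
Qed.

Lemma triC (R : realType) (B : bolAlgebra R) (x y z : B) : tri x y z = - tri y x z.
Proof.
have triDl u v w : @tri R B (u + v) w z = tri u w z + tri v w z.
  by have := tri_linear1 w z 1 u v; rewrite !scale1r.
have triDr u v w : @tri R B w (u + v) z = tri w u z + tri w v z.
  by have := tri_linear2 w z 1 u v; rewrite !scale1r.
have := tri_alt (x + y) z.
by rewrite triDl !triDr !tri_alt addr0 add0r => /eqP; rewrite addr_eq0 => /eqP.
Qed.

Lemma triZr (R : realType) (B : bolAlgebra R) (x y z : B) (a : R) :
  tri x y (a *: z) = a *: tri x y z.
Proof. exact: linearZ. Qed.

Lemma triDr (R : realType) (B : bolAlgebra R) (x y z t : B) :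
  tri x y (z + t) = tri x y z + tri x y t.
Proof. exact: linearD. Qed.

Lemma tri_comb1 (R : realType) (B : bolAlgebra R) (a b c : R)
    (u v w y z : B) :
  tri (a *: u + b *: v + c *: w) y z
    = a *: tri u y z + b *: tri v y z + c *: tri w y z.
Proof.
have triZ k t : @tri R B (k *: t) y z = k *: tri t y z.
  have tri0 : @tri R B 0 y z = 0.
    by have := tri_linear1 y z (- 1) 0 0; rewrite scaler0 addr0 scaleN1r addNr.
  by have := tri_linear1 y z k t 0; rewrite tri0 !addr0.
rewrite -addrA (@tri_linear1 R B y z a u) (@tri_linear1 R B y z b v) triZ.
by rewrite addrA.
Qed.

(** * Exponentials of endomorphisms acting on a plane *)

(** If the iterates of [v] stay in the plane of [v] and [w], the exponential is
    given by two scalar series, whatever the basis in which coordinates are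
    taken. *)
Lemma exp_end_plane (R : realType) (V : vectType R) (f : V -> V) (v w : V)
    (a b : nat -> R) (s t : R) :
  (forall k, iter k f v = a k *: v + b k *: w) ->
  (series (fun k => a k / k`!%:R) @ \oo --> s)%classic ->
  (series (fun k => b k / k`!%:R) @ \oo --> t)%classic ->
  exp_end f v = s *: v + t *: w.
Proof.
move=> fE sE tE; rewrite [RHS](coord_vbasis (memvf _)) /exp_end.
apply: eq_bigr => j _; congr (_ *: _).
apply: cvg_lim => //; rewrite linearD !linearZ /=.
rewrite [X in (X @ _)%classic](_ : _ = (fun n =>
  series (fun k => a k / k`!%:R) n * coord (vbasis fullv) j v +
  series (fun k => b k / k`!%:R) n * coord (vbasis fullv) j w)).
  by apply: cvgD; apply: cvgM => //; exact: cvg_cst.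
apply/funext => n; rewrite /series /= !mulr_suml -big_split /=.
by apply: eq_bigr => k _; rewrite fE linearD !linearZ /=; ring.
Qed.

Lemma exp_end_nilpotent (R : realType) (V : vectType R) (f : V -> V) (v : V) :
  f (f v) = 0 -> f 0 = 0 -> exp_end f v = v + f v.
Proof.
move=> ffv f0.
have series_delta m : (series (fun k => (k == m)%:R / k`!%:R) @ \oo
    --> ((m`!%:R)^-1 : R))%classic.
  apply: cvg_near_cst; exists m.+1 => // n /= mn.
  rewrite /series /= big_mkord (bigD1 (Ordinal mn)) //= eqxx mul1r.
  rewrite big1 ?addr0 // => k; rewrite -val_eqE /= => /negbTE ->.
  by rewrite mul0r.
rewrite (@exp_end_plane _ _ f v (f v) (fun k => (k == 0%N)%:R)
  (fun k => (k == 1%N)%:R) _ _ _ (series_delta 0%N) (series_delta 1%N)).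
  by rewrite fact0 invr1 !scale1r.
case=> [|[|k]] /=; rewrite ?scale1r ?scale0r ?addr0 ?add0r //.
rewrite -[LHS]/(iter k.+2 f v) !iterSr ffv.
by elim: k => //= k ->.
Qed.

(** The coefficients of the iterates on [v] and [w] are exactly those of the
    power series that define cosine and sine. *)
Lemma exp_end_rotation (R : realType) (V : vectType R) (f : {linear V -> V})
    (v w : V) (theta : R) :
  f v = theta *: w -> f w = - theta *: v ->
  exp_end f v = cos theta *: v + sin theta *: w.
Proof.
move=> fv fw.
pose a k : R := (~~ odd k)%:R * (-1) ^+ k./2 * theta ^+ k.
pose b k : R := (odd k)%:R * (-1) ^+ k.-1./2 * theta ^+ k.
apply: (@exp_end_plane _ _ f v w a b).
- elim=> [|k IH]; first by rewrite /a /b /= !mul1r mul0r mul0r scale0r scale1r addr0.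
  rewrite iterS IH linearD !linearZ /= fv fw !scalerA addrC.
  congr (_ *: _ + _ *: _); rewrite /a /b /= exprS; last by ring.
  (* The predecessor in [b] is truncated at k = 0, where the factor [odd k]
     vanishes anyway. *)
  rewrite negbK uphalf_half; case: k {IH} => [|k] /=; first by rewrite !mul0r.
  rewrite uphalf_half; case: (odd k); rewrite /= ?mul0r // ?add0n ?add1n (exprS (-1)).
  ring.
- by rewrite unlock; apply: is_cvg_series_cos_coeff.
- by rewrite unlock; apply: is_cvg_series_sin_coeff.
Qed.

(** * Triple systems of type V+ *)

Lemma basis3_decomposition (R : realType) (V : vectType R) (e1 e2 e3 v : V) :
  basis_of fullv [:: e1; e2; e3] ->
  exists a b c : R, v = a *: e1 + b *: e2 + c *: e3.
Proof.
move=> eB; pose X := [tuple e1; e2; e3].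
exists (coord X 0 v), (coord X 1 v), (coord X 2 v).
rewrite {1}(coord_basis (X := X) eB (memvf v)) !big_ord_recr big_ord0 /= add0r.
by congr (_ *: _ + _ *: _ + _ *: _); congr (coord _ _ _); exact: val_inj.
Qed.

Lemma basis3_eq0 (R : realType) (V : vectType R) (e1 e2 e3 : V) (a b c : R) :
  basis_of fullv [:: e1; e2; e3] ->
  a *: e1 + b *: e2 + c *: e3 = 0 -> [/\ a = 0, b = 0 & c = 0].
Proof.
move=> /basis_free eF eE; pose X := [tuple e1; e2; e3].
have /freeP k0 : free X by [].
have /k0 kE : \sum_(j < 3) [:: a; b; c]`_j *: X`_j = 0.
  by rewrite !big_ord_recr big_ord0 /= add0r.
by split; [exact: (kE ord0) | exact: (kE (lift ord0 ord0)) | exact: (kE ord_max)].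
Qed.

Section TypeVplus.
Context {R : realType} {B : bolAlgebra R} {e1 e2 e3 : B}.
Context (eV : typeVplus_basis e1 e2 e3).

Lemma Vplus_free a b c :
  a *: e1 + b *: e2 + c *: e3 = 0 -> [/\ a = 0, b = 0 & c = 0].
Proof. by case: eV => eB _ _ _; exact: basis3_eq0. Qed.

Lemma Vplus_free12 a b : a *: e1 - b *: e2 = 0 -> a = 0 /\ b = 0.
Proof.
move=> ab0; have /Vplus_free[-> /eqP] : a *: e1 + (- b) *: e2 + 0 *: e3 = 0.
  by rewrite scale0r addr0 scaleNr.
by rewrite oppr_eq0 => /eqP.
Qed.

Lemma Vplus_e1_neq0 : e1 != 0.
Proof.
apply/eqP => e10; have /Vplus_free12[/eqP] : 1 *: e1 - 0 *: e2 = 0.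
  by rewrite e10 scaler0 scale0r subr0.
by rewrite oner_eq0.
Qed.

Lemma Vplus_tri v : exists a b c,
  [/\ v = a *: e1 + b *: e2 + c *: e3, tri e1 e2 v = 0, tri e1 e3 v = 0 &
      tri e2 e3 v = b *: e1 - c *: e2].
Proof.
case: eV => eB t12 t13 [t231 t232 t233].
have [a [b [c ->]]] := basis3_decomposition v eB; exists a, b, c.
have [m1 m2 m3] : [/\ e1 \in [:: e1; e2; e3], e2 \in [:: e1; e2; e3] &
    e3 \in [:: e1; e2; e3]] by rewrite !inE !eqxx !orbT.
rewrite !linearD !linearZ /= t231 t232 t233 !t12 // !t13 //.
by rewrite !scaler0 !addr0 add0r scalerN.
Qed.

Lemma Vplus_tri_e1 x y : tri e1 x y = 0.
Proof.
case: (eV) => eB _ _ _; have [a [b [c ->]]] := basis3_decomposition x eB.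
have [_ [_ [_ [_ t12 t13 _]]]] := Vplus_tri y.
rewrite triC tri_comb1 tri_alt (triC e2) (triC e3) t12 t13.
by rewrite oppr0 !scaler0 !addr0 oppr0.
Qed.

(** These are the basis changes of type V+ in which [e3] keeps coefficient 1; the
    coefficient of [e1] in the new [e2] is forced by the value of
    [tri e2 e3 e3]. *)
Lemma Vplus_rebase (s p q : R) : s != 0 ->
  typeVplus_basis ((s * s) *: e1) (s *: e2 - (s * p) *: e1)
    (e3 + p *: e2 + q *: e1).
Proof.
move=> s0; case: (eV) => eB _ _ [t231 t232 t233].
have t1 k x y : tri (k *: e1) x y = 0.
  have -> : k *: e1 = k *: e1 + 0 *: e1 + 0 *: e1 by rewrite !scale0r !addr0.
  by rewrite tri_comb1 !Vplus_tri_e1 !scaler0 !addr0.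
have t23 y : tri (s *: e2 - (s * p) *: e1) (e3 + p *: e2 + q *: e1) y
    = s *: tri e2 e3 y.
  have -> : s *: e2 - (s * p) *: e1
      = s *: e2 + (- (s * p)) *: e1 + 0 *: e1.
    by rewrite scale0r addr0 scaleNr.
  rewrite tri_comb1 !Vplus_tri_e1 !scaler0 !addr0 triC -[e3]scale1r tri_comb1.
  by rewrite Vplus_tri_e1 tri_alt !scaler0 !addr0 !scale1r -triC.
split; last first.
- split; rewrite t23.
  + by rewrite triZr t231 !scaler0.
  + by rewrite linearB /= !triZr t231 t232 scaler0 subr0 scalerA.
  + rewrite !triDr !triZr t231 t232 t233 scaler0 addr0.
    by rewrite scalerDr scalerN scalerA addrC opprB.
- by move=> z _; rewrite t1.
- by move=> z _; rewrite t1.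
rewrite basisEdim (@size_basis _ _ _ _ [tuple e1; e2; e3] eB) leqnn andbT.
case/andP: eB => /eqP <- _; apply/span_subvP => x.
set X := [:: (s * s) *: e1; _; _].
have [x1 x2 x3] : [/\ X`_0 \in <<X>>, X`_1 \in <<X>> & X`_2 \in <<X>>]%VS.
  by split; apply: memv_span; rewrite mem_nth.
have m1 : e1 \in <<X>>%VS.
  by rewrite -(scalerK (mulf_neq0 s0 s0) e1); apply: memvZ; exact: x1.
have m2 : e2 \in <<X>>%VS.
  rewrite -(scalerK s0 e2) memvZ // -(subrK ((s * p) *: e1) (s *: e2)).
  by rewrite memvD ?(memvZ _ m1) //; exact: x2.
have m3 : e3 \in <<X>>%VS.
  have -> : e3 = (e3 + p *: e2 + q *: e1) - q *: e1 - p *: e2.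
    by rewrite addrK addrK.
  by rewrite !memvB ?(memvZ _ m1) ?(memvZ _ m2) //; exact: x3.
by rewrite !inE => /or3P[] /eqP ->.
Qed.

End TypeVplus.

(** * The envelope is the oscillator algebra *)

Section Envelope.
Context {R : realType} {B : bolAlgebra R} {e1 e2 e3 : B}.
Context (eV : typeVplus_basis e1 e2 e3).
Context {G : lieAlgebra R} {i : 'Hom(B, G)} {h : {vspace G}}.
Context (iE : enveloping_pair i h).
Local Notation D := (lie (i e2) (i e3)).

(** If [D] were the image of [v], then [tri e2 e3 v], which is the bracket of [D]
    with itself, would vanish and [v] would be a multiple of [e1].  Then [e1],
    the bracket of [D] with [e2], would be a multiple of the bracket of [e1] and
    [e2]; as the latter commutes with [e2], it would vanish, and [e1] with it. *)
Lemma envelope_notin : D \notin limg i.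
Proof.
apply/negP => /memv_imgP[v _ Dv].
have [a [b [c [vE t12 _ t23]]]] := Vplus_tri eV v.
have [_ _ _ [_ t232 _]] := eV.
have /(Vplus_free12 eV)[b0 c0] : b *: e1 - c *: e2 = 0.
  by apply: (env_inj iE); rewrite -t23 (env_tri iE) -Dv lie_alt linear0.
have E1 : i e1 = a *: lie (i e1) (i e2).
  by rewrite -{1}t232 (env_tri iE) Dv vE b0 c0 !scale0r !addr0 linearZ lieZl.
have E12 : lie (i e1) (i e2) = 0.
  rewrite E1 lieZl -(env_tri iE); have [? [? [? [_ -> _ _]]]] := Vplus_tri eV e2.
  by rewrite linear0 scaler0.
have /eqP[] := Vplus_e1_neq0 eV; apply: (env_inj iE).
by rewrite E1 E12 scaler0 linear0.
Qed.

Lemma lie_D v : lie D (i v) = i (tri e2 e3 v).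
Proof. by rewrite (env_tri iE). Qed.

Context (dimB : \dim (fullv : {vspace B}) = 3%N).
Context (dimG : \dim (fullv : {vspace G}) = 4%N).

Lemma dim_limg : \dim (limg i) = 3%N.
Proof.
have /lker0P/eqP kerE := env_inj iE.
by rewrite limg_dim_eq ?dimB // kerE capv0.
Qed.

Lemma envelope_cap : (limg i :&: <[D]> = 0)%VS.
Proof.
apply/eqP; rewrite -subv0; apply/subvP => u /memv_capP[ui /vlineP[t uE]].
rewrite memv0 uE scaler_eq0; case: eqVneq => //= t0.
have := envelope_notin; rewrite -[X in X \notin _](scalerK t0).
by rewrite -uE memvZ.
Qed.

Lemma envelope_sum : (limg i + <[D]> = fullv)%VS.
Proof.
apply/eqP; rewrite eqEdim subvf dimG (dimv_disjoint_sum envelope_cap).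
rewrite dim_limg dim_vline; case: eqVneq => //= D0.
by have := envelope_notin; rewrite D0 mem0v.
Qed.

Lemma envelope_decomposition u : exists v t, u = i v + t *: D.
Proof.
have : u \in (limg i + <[D]>)%VS by rewrite envelope_sum memvf.
move=> /memv_addP[_ /memv_imgP[v _ ->] [_ /vlineP[t ->] ->]].
by exists v, t.
Qed.

(** Such a [u] also commutes with [D] by the Jacobi identity, and the centralizer
    of [D] is spanned by [e1] and [D]; the two remaining equations are the
    hypotheses rewritten for [u] in this plane. *)
Lemma envelope_centralizer u :
    lie u (i e2) = 0 -> lie u (i e3) = 0 ->
  exists a t, [/\ u = a *: i e1 + t *: D,
    a *: lie (i e1) (i e2) + t *: i e1 = 0 &
    a *: lie (i e1) (i e3) - t *: i e2 = 0].
Proof.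
have [v [t ->]] := envelope_decomposition u => u2 u3.
have [_ _ _ [_ t232 t233]] := eV.
have [a [b [c [vE _ _ t23]]]] := Vplus_tri eV v.
have /(Vplus_free12 eV)[b0 c0] : b *: e1 - c *: e2 = 0.
  apply: (env_inj iE); rewrite -t23 -lie_D linear0.
  have := lie_jacobi (i v + t *: D) (i e2) (i e3).
  rewrite u2 linear0 addr0 [lie (i e3) _]lieC u3 oppr0 linear0 addr0.
  rewrite lieC linearD linearZ /= lie_alt scaler0 addr0 => /eqP.
  by rewrite oppr_eq0 => /eqP.
move: u2 u3.
rewrite vE b0 c0 !scale0r !addr0 !lieDl [i (_ *: _)]linearZ !lieZl !lie_D.
rewrite t232 t233 linearN scalerN /= => u2 u3.
by exists a, t.
Qed.

(** Both brackets commute with the image of [B], since [tri e1 e2] and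
    [tri e1 e3] vanish, so they are governed by [envelope_centralizer]. *)
Lemma envelope_e1_central :
  lie (i e1) (i e2) = 0 /\ lie (i e1) (i e3) = 0.
Proof.
have t12 v : lie (lie (i e1) (i e2)) (i v) = 0.
  rewrite -(env_tri iE); have [? [? [? [_ -> _ _]]]] := Vplus_tri eV v.
  by rewrite linear0.
have t13 v : lie (lie (i e1) (i e3)) (i v) = 0.
  rewrite -(env_tri iE); have [? [? [? [_ _ -> _]]]] := Vplus_tri eV v.
  by rewrite linear0.
have e1N0 : i e1 != 0.
  by have := Vplus_e1_neq0 eV; rewrite -(inj_eq (env_inj iE)) linear0.
have E12 : lie (i e1) (i e2) = 0.
  have [a [t [cE at1 _]]] := envelope_centralizer (t12 e2) (t12 e3).
  have [t0|tN0] := eqVneq t 0.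
    move: at1 cE; rewrite t0 !scale0r !addr0 => /eqP.
    by rewrite scaler_eq0 => /orP[/eqP -> ->|/eqP //]; rewrite scale0r.
  have E1 : i e1 = (- a / t) *: lie (i e1) (i e2).
    apply: (scalerI tN0); rewrite scalerA mulrC divfK // scaleNr.
    by apply/eqP; rewrite -addr_eq0 addrC; exact/eqP.
  by rewrite {1}E1 lieZl t12 scaler0.
split=> //.
have [a [t [cE at1 at2]]] := envelope_centralizer (t13 e2) (t13 e3).
move: at1 at2 cE; rewrite E12 scaler0 add0r => /eqP.
rewrite scaler_eq0 (negbTE e1N0) orbF => /eqP ->.
rewrite !scale0r subr0 addr0 => /eqP.
by rewrite scaler_eq0 => /orP[/eqP -> ->|/eqP //]; rewrite scale0r.
Qed.

End Envelope.

(** * Isotopies inside one Lie algebra *)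

(** Every term of the Bol identity contains the product, hence any triple system
    underlying a Bol algebra also carries the zero product.  The definition is
    transparent, and keeps the underlying space and [tri], so that maps from
    [B] and bases of [B] are maps from and bases of the new algebra. *)
Definition bol_trivial_dot (R : realType) (B : bolAlgebra R) : bolAlgebra R.
Proof.
apply: (@BolAlgebra R B (fun _ _ => 0) (@tri R B)).
- by move=> y a u v; rewrite scaler0 addr0.
- by move=> x a u v; rewrite scaler0 addr0.
- exact: tri_linear1.
- exact: tri_linear2.
- exact: tri_linear3.
- by [].
- exact: tri_alt.
- exact: tri_cyclic.
- exact: tri_deriv.
- by move=> x y z u /=; rewrite !linear0 !addr0.
Defined.

Lemma isotopic_common_envelope (R : realType) (B B' : bolAlgebra R)
    (G : lieAlgebra R) (i : 'Hom(B, G)) (i' : 'Hom(B', G)) (h h' : {vspace G})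
    (xi : G) :
  canonical_envelope i h -> canonical_envelope i' h' ->
  limg i = limg i' -> xi \in limg i' ->
  ([set` h] = Ad xi @` [set` h'])%classic -> isotopic B B'.
Proof.
move=> ci ci' ii' xiB hh'; exists G, i, h, G, i', h'; split=> //.
exists (\1)%VF, xi; split=> //.
- by split=> [|u v]; [exists id => u; rewrite id_lfunE | rewrite !id_lfunE].
- by rewrite lim1g.
- by rewrite -hh'; apply/seteqP; split=> u /=; [case=> v hv <- | exists u => //];
    rewrite id_lfunE.
Qed.

(** Take the identity isomorphism and [xi = 0], for which [Ad] is the identity. *)
Lemma isotopic_refl (R : realType) (B : bolAlgebra R) (G : lieAlgebra R)
    (i : 'Hom(B, G)) (h : {vspace G}) :
  canonical_envelope i h -> isotopic B B.
Proof.
move=> ci; apply: (isotopic_common_envelope (xi := 0) ci ci) => //.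
  exact: mem0v.
have Ad0 (v : G) : Ad 0 v = v.
  by rewrite /Ad exp_end_nilpotent ?lie0l ?linear0 ?addr0.
by apply/seteqP; split=> u /=; [exists u | case=> v hv <-]; rewrite ?Ad0.
Qed.

Lemma Ad_line (R : realType) (G : lieAlgebra R) (xi u v : G) (k : R) :
  k != 0 -> (forall t, Ad xi (t *: u) = (t * k) *: v) ->
  ([set` <[v]>%VS] = Ad xi @` [set` <[u]>%VS])%classic.
Proof.
move=> k0 AdE; apply/seteqP; split=> w /=.
  move=> /vlineP[t ->]; exists ((t / k) *: u); first by rewrite /= memvZ ?memv_line.
  by rewrite AdE divfK.
by case=> _ /vlineP[t ->] <-; rewrite AdE memvZ ?memv_line.
Qed.

(** * Normalizing the complement *)

Section CanonicalEnvelope.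
Context {R : realType} {B : bolAlgebra R} {e1 e2 e3 : B}.
Context {G : lieAlgebra R} {i : 'Hom(B, G)} {h : {vspace G}}.
Context (eV : typeVplus_basis e1 e2 e3) (ci : canonical_envelope i h).
Context (dimB : \dim (fullv : {vspace B}) = 3%N).
Context (dimG : \dim (fullv : {vspace G}) = 4%N).
Local Notation D := (lie (i e2) (i e3)).
Let iE : enveloping_pair i h := canon_enveloping ci.

Lemma lie_brackets : [/\ lie (i e1) (i e2) = 0, lie (i e1) (i e3) = 0,
  lie D (i e1) = 0, lie D (i e2) = i e1 & lie D (i e3) = - i e2].
Proof.
have [_ _ _ [t1 t2 t3]] := eV.
have [E12 E13] := envelope_e1_central eV iE dimB dimG.
by rewrite !(lie_D iE) t1 t2 t3 linear0 linearN.
Qed.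

Lemma lie_line u v : lie (i u) (i v) \in <[D]>%VS.
Proof.
have [E12 E13 _ _ _] := lie_brackets; have [eB _ _ _] := eV.
have [a [b [c ->]]] := basis3_decomposition u eB.
have [a' [b' [c' ->]]] := basis3_decomposition v eB.
rewrite !linearD /= !lieDl ![i (_ *: _)]linearZ /= !lieZl !lieZr.
rewrite (lieC (i e2) (i e1)) (lieC (i e3) (i e1)) (lieC (i e3) (i e2)).
rewrite E12 E13 !lie_alt !oppr0.
by rewrite !memvD ?memvZ ?memvN ?mem0v ?memv_line.
Qed.

(** [D] minus its projection to the image of [B] lies in [h], and is nonzero because
    [D] is outside that image; [h] has dimension 4 - 3. *)
Lemma complement_line : h = <[D - i (dot e2 e3)]>%VS.
Proof.
have wh : D - i (dot e2 e3) \in h.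
  rewrite (env_dot iE).
  have Dsum : D \in (limg i + h)%VS by rewrite (env_sum iE) memvf.
  rewrite -{1}(daddv_pi_add (env_direct iE) Dsum) addrC addKr.
  exact: memv_pi.
apply/eqP; rewrite eq_sym eqEdim -memvE wh dim_vline.
have := dimv_disjoint_sum (env_direct iE).
rewrite (env_sum iE) dimG (dim_limg iE dimB) => -[]; rewrite add0n => <-.
case: eqVneq => // /eqP; rewrite subr_eq0 => /eqP DE.
by have := envelope_notin eV iE; rewrite DE memv_img ?memvf.
Qed.

Lemma dot_e1 : dot e1 e2 = 0 /\ dot e1 e3 = 0.
Proof.
have [E12 E13 _ _ _] := lie_brackets.
by split; apply: (env_inj iE); rewrite (env_dot iE) ?E12 ?E13 !linear0.
Qed.

(** The zero product is the projection parallel to the line of [D] because that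
    line contains all brackets of elements of the image of [B].  The line
    contains no nonzero ideal: bracketing [t D] with [e3] gives [t e2], outside the
    line unless [t = 0]. *)
Lemma canonical_trivial_dot :
  @canonical_envelope R (bol_trivial_dot B) G i <[D]>%VS.
Proof.
have capE := envelope_cap eV iE.
have sumE := envelope_sum eV iE dimB dimG.
split.
- split=> //.
  + exact: env_inj iE.
  + move=> u v /vlineP[s ->] /vlineP[t ->].
    by rewrite lieZl lieZr lie_alt !scaler0 mem0v.
  + exact: env_triple_closed iE.
  + move=> x y /=; rewrite linear0.
    have wD : lie (i x) (i y) \in <[D]>%VS := lie_line x y.
    have wS : lie (i x) (i y) \in (limg i + <[D]>)%VS by rewrite sumE memvf.
    have capE' : (<[D]> :&: limg i = 0)%VS by rewrite capvC.
    apply: (addIr (lie (i x) (i y))).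
    by rewrite -{3}(daddv_pi_id capE' wD) daddv_pi_add // add0r.
  + exact: env_tri iE.
- exact: canon_generates ci.
- move=> I Iid /subvP IhD; apply/eqP; rewrite -subv0; apply/subvP => u uI.
  have [_ _ _ D2 D3] := lie_brackets.
  have [t uE] := vlineP _ _ (IhD u uI).
  have /IhD : lie (i e3) u \in I by exact: Iid.
  rewrite uE lieZr lieC D3 opprK => tD.
  have /eqP te2 : t *: i e2 == 0.
    by rewrite -memv0 -capE memv_cap tD memvZ ?memv_img ?memvf.
  have : t *: i e1 = 0 by rewrite -D2 -lieZr te2 linear0.
  move/eqP; rewrite scaler_eq0 => /orP[/eqP ->|/eqP E1].
    by rewrite scale0r mem0v.
  by have := Vplus_e1_neq0 eV; rewrite -(inj_eq (env_inj iE)) E1 linear0 eqxx.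
Qed.

(** The complement [h] and the line of [D] are conjugate under [Ad xi] for some
    [xi] in the image of [B]: a shear along [e1] if [b = 0], and a
    rotation otherwise. *)
Lemma Vplus_isotopic_trivial (a b : R) :
  dot e2 e3 = a *: e1 + b *: e2 -> isotopic B (bol_trivial_dot B).
Proof.
move=> dE; have [E12 E13 D1 D2 D3] := lie_brackets.
have iZ k x : i (k *: x) = k *: i x by exact: linearZ.
suff [xi [k [v [xiB k0 vE AdE]]]] : exists xi k v, [/\ xi \in limg i, k != 0,
    v = D - i (dot e2 e3) & forall t, Ad xi (t *: D) = (t * k) *: v].
  apply: (isotopic_common_envelope (xi := xi) ci canonical_trivial_dot) => //.
  by rewrite complement_line -vE; exact: Ad_line AdE.
have [b0|bN0] := eqVneq b 0.
  exists (a *: i e2), 1, (D - a *: i e1); split.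
  - by rewrite memvZ ?memv_img ?memvf.
  - exact: oner_neq0.
  - by rewrite dE b0 scale0r addr0 iZ.
  move=> t; have fD : lie (a *: i e2) (t *: D) = - ((t * a) *: i e1).
    by rewrite lieZl lieZr (lieC (i e2)) D2 !scalerN scalerA mulrC.
  rewrite /Ad exp_end_nilpotent ?linear0 //; last first.
    by rewrite fD linearN /= lieZl lieZr lieC E12 oppr0 !scaler0 oppr0.
  by rewrite fD mulr1 scalerDr scalerN scalerA.
(* The operator [ad (e3 + c e2)] rotates the plane of [D] and [e2 - c e1].  The
   spanning vector of [h] lies in this plane for [c = - a / b], and the angle
   to reach it from [D] has tangent [- b]. *)
pose c := - a / b; pose theta := atan (- b).
have cos0 : cos theta != 0.
  by rewrite gt_eqF // cos_gt0_pihalf // atan_gtNpi2 atan_ltpi2.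
have sinE : sin theta = - b * cos theta.
  by rewrite -[X in X * _](atanK (- b)) /tan divfK.
exists (theta *: (i e3 + c *: i e2)), (cos theta), (D - a *: i e1 - b *: i e2).
split=> //.
- by rewrite memvZ ?memvD ?memvZ ?memv_img ?memvf.
- by rewrite dE [i (_ + _)]linearD /= !iZ opprD addrA.
move=> t; rewrite /Ad.
rewrite (exp_end_rotation (w := t *: (i e2 - c *: i e1)) (theta := theta)).
- rewrite sinE !scalerA !scalerBr !scalerA -!addrA [cos theta * t]mulrC.
  rewrite [X in _ + X = _]addrC; congr (_ + (_ + _)).
    by congr (- (_ *: _)); rewrite /c; field.
  by rewrite -scaleNr; congr (_ *: _); ring.
- rewrite /= lieZl lieZr lieDl lieZl (lieC (i e3) D) (lieC (i e2) D) D2 D3 opprK.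
  by rewrite scalerN.
- rewrite /= lieZl lieZr lieDr lieNr lieZr !lieDl !lieZl lie_alt.
  rewrite (lieC (i e3) (i e1)) (lieC (i e2) (i e1)) E12 E13 !oppr0.
  by rewrite !scaler0 !addr0 scaler0 subr0 lieC !scalerN scaleNr.
Qed.

(** Rebasing with [s = - 1 / c], [p = b / c], [q = a / c] makes the new [e3] equal
    to [(e2 . e3) / c], while the new product of [e2] and [e3] is
    [s (e2 . e3)]. *)
Lemma Vplus_normal_form (a b c : R) : c != 0 ->
  dot e2 e3 = a *: e1 + b *: e2 + c *: e3 ->
  exists f1 f2 f3 : B, [/\ typeVplus_basis f1 f2 f3, dot f1 f2 = 0,
    dot f1 f3 = 0 & dot f2 f3 = - f3].
Proof.
move=> c0 dE; have [d12 d13] := dot_e1.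
have s0 : - c^-1 != 0 by rewrite oppr_eq0 invr_eq0.
have := Vplus_rebase eV (b / c) (a / c) s0.
set f1 := (X in typeVplus_basis X); set f2 := (X in typeVplus_basis _ X).
set f3 := (X in typeVplus_basis _ _ X) => fV; exists f1, f2, f3.
have dotZr k x y : dot x (k *: y) = k *: dot x y :> B by exact: linearZ.
have dotDr x y z : dot x (y + z) = dot x y + dot x z :> B by exact: linearD.
have dotx1 x : dot x e1 = 0.
  have [eB _ _ _] := eV; have [p [q [r ->]]] := basis3_decomposition x eB.
  by rewrite dotC !dotDr !dotZr d12 d13 dot_alt !scaler0 !addr0 oppr0.
have dotx1' k x : dot x (k *: e1) = 0 by rewrite dotZr dotx1 scaler0.
split=> //.
- by rewrite dotC dotx1' oppr0.
- by rewrite dotC dotx1' oppr0.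
rewrite dotC /f2 dotDr -scaleNr dotx1' addr0 dotZr dotC /f3 !dotDr dotx1' dotZr.
rewrite dot_alt scaler0 !addr0 dE !scalerN opprK scaleNr !scalerDr !scalerA.
rewrite mulVf // scale1r; congr (- _).
by rewrite ![_^-1 * _]mulrC addrC [X in _ + X = _]addrC addrA.
Qed.

End CanonicalEnvelope.

Theorem mainTheorem13 (R : realType) (B : bolAlgebra R)
  (G : lieAlgebra R) (i : 'Hom(B, G)) (h : {vspace G}) :
  \dim (fullv : {vspace B}) = 3%N ->
  typeVplus B ->
  canonical_envelope i h ->
  \dim (fullv : {vspace G}) = 4%N ->
  exists (B' : bolAlgebra R) (e1 e2 e3 : B'),
    [/\ isotopic B B',
        typeVplus_basis e1 e2 e3,
        dot e1 e2 = 0,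
        dot e1 e3 = 0 &
        [\/ dot e2 e3 = - e3,
            dot e2 e3 = e2 |
            dot e2 e3 = 0]].
Proof.
move=> dimB [e1 [e2 [e3 eV]]] ci dimG; have [eB _ _ _] := eV.
have [a [b [c dE]]] := basis3_decomposition (dot e2 e3) eB.
have [c0|cN0] := eqVneq c 0.
  exists (bol_trivial_dot B), e1, e2, e3; split=> //; last exact: Or33.
  apply: (Vplus_isotopic_trivial eV ci dimB dimG (a := a) (b := b)).
  by rewrite dE c0 scale0r addr0.
have [f1 [f2 [f3 [fV f12 f13 f23]]]] :=
  Vplus_normal_form eV ci dimB dimG cN0 dE.
by exists B, f1, f2, f3; split; [exact: isotopic_refl ci | | | | exact: Or31].
Qed.
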